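(* Let $K$ be an algebraically closed field and let $A=J(Q,W)$ be a polygon-tree algebra over $K$. Then $A$ is a finite-dimensional algebra. Moreover, for every vertex $i$ of $Q$, the simple $A$-module ${}_AS_i$ is not (isomorphic to) a submodule of the radical of the indecomposable projective $A$-module $P_i=Ae_i$.
   Context: A quiver with potential (QP) $(Q,W)$ is a quiver $Q$ with a (possibly infinite) linear combination $W$ of cyclic paths. The cyclic derivative is $\partial_a(a_1\cdots a_l)=\sum_{a_i=a}a_{i+1}\cdots a_la_1\cdots a_{i-1}$, extended linearly and continuously. The Jacobian algebra $J(Q,W)$ is the quotient of the complete path algebra $\widehat{KQ}$ by the closure of the ideal generated by all $\partial_aW$, $a$ an arrow of $Q$. Polygon-tree algebras. Let $Q_0,\dots,Q_N$ ($N\ge 0$) be oriented cycles with at least $3$ vertices each. Start with $Q_0$. For $t=1,\dots,N$ inductively, choose an arrow of the quiver $Q_{0,\dots,t-1}$ already constructed which is not one of the arrows previously used for a gluing, and an arrow of $Q_t$, and let $Q_{0,\dots,t}$ be obtained from $Q_{0,\dots,t-1}$ and $Q_t$ by identifying these two arrows (with their sources and targets). The quiver $Q=Q_{0,\dots,N}$ is a polygon-tree quiver. With $W=\sum_{i=0}^N w_i$, $w_i$ the oriented cycle along $Q_i$, the Jacobian algebra $J(Q,W)$ is a polygon-tree algebra. Modules are left modules; $P_i=Ae_i$ is spanned by the images of the paths starting at $i$, and $S_i$ is the simple top of $P_i$. *)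

(* Defs.v *)
From HB Require Import structures.
From mathcomp Require Import all_boot all_order all_algebra.
From mathcomp Require Import boolp functions.

Set Implicit Arguments.
Unset Strict Implicit.
Unset Printing Implicit Defensive.

Import GRing.Theory.
Local Open Scope ring_scope.
Local Open Scope quotient_scope.

Section QuotientModule.
Variables (R : pzRingType) (M : lmodType R) (U : submodClosed M).

(* Over a ring, closure under opposites follows from closure under scaling;
   the library structure [submodClosed] does not record it. *)
Definition quotmod_pred : {pred M} := U.

Fact quotmod_pred_closed : zmod_closed quotmod_pred.
Proof. exact: GRing.submod_closedB (submodClosedP U). Qed.

HB.instance Definition _ :=
  GRing.isZmodClosed.Build M quotmod_pred quotmod_pred_closed.

Definition quotmod : Type := Quotient.quot quotmod_pred.

HB.instance Definition _ := GRing.Zmodule.on quotmod.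
HB.instance Definition _ :=
  EqQuotient.copy quotmod (Quotient.quot quotmod_pred).

Definition quotmod_scale (k : R) (x : quotmod) : quotmod :=
  \pi_quotmod (k *: repr x).

Fact quotmod_pi_eq (x y : M) :
  (\pi_quotmod x == \pi_quotmod y) = (x - y \in quotmod_pred).
Proof. by rewrite Quotient.idealrBE. Qed.

Fact quotmod_piD (x y : M) :
  \pi_quotmod (x + y) = \pi_quotmod x + \pi_quotmod y.
Proof. exact: Quotient.pi_add. Qed.

Fact quotmod_pi_scale k (x : M) :
  quotmod_scale k (\pi_quotmod x) = \pi_quotmod (k *: x).
Proof.
apply/eqP; rewrite quotmod_pi_eq -scalerBr; apply: (@rpredZ _ _ U).
rewrite -[_ \in _]/(_ \in quotmod_pred) -quotmod_pi_eq.
by rewrite reprK.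
Qed.

Fact quotmod_scalerA a b v :
  quotmod_scale a (quotmod_scale b v) = quotmod_scale (a * b) v.
Proof.
elim/quotW: v => v.
by rewrite (quotmod_pi_scale b) !(quotmod_pi_scale _) scalerA.
Qed.

Fact quotmod_scale1r : left_id 1 quotmod_scale.
Proof. by move=> v; rewrite -[v]reprK quotmod_pi_scale scale1r. Qed.

Fact quotmod_scalerDr : right_distributive quotmod_scale +%R.
Proof.
move=> a u v; rewrite -[u]reprK -[v]reprK -quotmod_piD !quotmod_pi_scale.
by rewrite scalerDr quotmod_piD.
Qed.

Fact quotmod_scalerDl v : {morph quotmod_scale^~ v : a b / a + b}.
Proof.
by move=> a b; rewrite /= -[v]reprK !quotmod_pi_scale scalerDl quotmod_piD.
Qed.

HB.instance Definition _ := GRing.Zmodule_isLmodule.Build R quotmod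
  quotmod_scalerA quotmod_scale1r quotmod_scalerDr quotmod_scalerDl.

End QuotientModule.

Section Radical.
Variables (R : pzRingType) (M : lmodType R).

Definition maximal_submod (S : {pred M}) : Prop :=
  [/\ submod_closed S, exists x, x \notin S &
      forall T : {pred M}, submod_closed T -> {subset S <= T} ->
        T =i S \/ T =i predT].

Definition rad : {pred M} :=
  fun x => `[< forall S : {pred M}, maximal_submod S -> x \in S >].

Fact rad_closed : subsemimod_closed rad.
Proof.
apply: GRing.submod_closed_semi; split.
  by apply/asboolP => S [[S0 _] _ _].
move=> a u v /asboolP Ru /asboolP Rv; apply/asboolP => S mS.
by case: (mS) => [[_ SL] _ _]; apply: SL; [apply: Ru | apply: Rv].
Qed.

HB.instance Definition _ := GRing.isSubmodClosed.Build R M rad rad_closed.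

Definition top := quotmod rad.
HB.instance Definition _ := GRing.Lmodule.on top.

End Radical.

Arguments rad {R} M _.

Record quiver := Quiver {
  vert : finType;
  arr : finType;
  src : arr -> vert;
  tgt : arr -> vert
}.

Section Paths.
Variable Q : quiver.
Implicit Types (i j : vert Q) (a b : arr Q) (w : seq (arr Q)).

(* Paths compose like functions: in a word a_1 ... a_l each a_{k+1} is
   followed by a_k, so that A e_i is spanned by the paths starting at i. *)
Definition composable a b := src a == tgt b.

Definition is_path j w :=
  if w is a :: w' then (tgt a == j) && path composable a w' else true.

(* A path is its target together with its word; the target is needed for the
   trivial paths. *)
Definition qpath := {p : vert Q * seq (arr Q) | is_path p.1 p.2}.

HB.instance Definition _ := Choice.on qpath.

Definition ptgt (p : qpath) : vert Q := (val p).1.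
Definition pword (p : qpath) : seq (arr Q) := (val p).2.
Definition plen (p : qpath) : nat := size (pword p).

Definition word_src j w := last j (map (@src Q) w).

Lemma is_path_cat j w1 w2 :
  is_path j (w1 ++ w2) = is_path j w1 && is_path (word_src j w1) w2.
Proof.
case: w1 => [|a w1] //=; rewrite cat_path -andbA; congr (_ && (_ && _)).
by case: w2 => [|b w2] //=; rewrite /word_src /composable /= last_map eq_sym.
Qed.

Fact pleft_subproof k p : is_path (ptgt p) (take k (pword p)).
Proof.
by have := valP p; rewrite -{1}(cat_take_drop k (val p).2) is_path_cat =>
  /andP[].
Qed.

Fact pright_subproof k p :
  is_path (word_src (ptgt p) (take k (pword p))) (drop k (pword p)).
Proof.
by have := valP p; rewrite -{1}(cat_take_drop k (val p).2) is_path_cat =>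
  /andP[].
Qed.

(* p = (pleft k p) (pright k p), where pleft k p has length k. *)
Definition pleft k p : qpath :=
  exist _ (ptgt p, take k (pword p)) (pleft_subproof k p).
Definition pright k p : qpath :=
  exist _ (word_src (ptgt p) (take k (pword p)), drop k (pword p))
    (pright_subproof k p).

End Paths.

Section CompletePathAlgebra.
Variables (Q : quiver) (K : fieldType).

(* An element of the complete path algebra is an arbitrary family of
   coefficients indexed by the paths. *)
Definition cpa : Type := qpath Q -> K.

HB.instance Definition _ := GRing.Zmodule.copy cpa (qpath Q -> K).
HB.instance Definition _ := GRing.Lmodule.copy cpa (qpath Q -> K^o).

Implicit Types (x y z : cpa) (p : qpath Q).

Definition cpa_one : cpa := fun p => (nilp (pword p))%:R.

Definition cpa_mul x y : cpa :=
  fun p => \sum_(k < (plen p).+1) x (pleft k p) * y (pright k p).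


Fact cpa_mul1r : left_id cpa_one cpa_mul.
Proof.
move=> x; apply/funext => p; rewrite /cpa_mul (bigD1 ord0) //= big1 => [|k k0].
  rewrite addr0 /cpa_one /pword /= take0 mul1r; congr (x _).
  by apply: val_inj; case: p => -[j w] pw; rewrite /= take0 /pword /= drop0.
rewrite /cpa_one /nilp /pword /= size_takel.
  by rewrite -[_ == 0%N]/(k == ord0) (negbTE k0) mul0r.
by rewrite -ltnS ltn_ord.
Qed.

Fact cpa_mulr1 : right_id cpa_one cpa_mul.
Proof.
move=> x; apply/funext => p; rewrite /cpa_mul (bigD1 ord_max) //= big1 => [|k kM].
  rewrite addr0 /cpa_one /pword /= drop_size mulr1; congr (x _).
  by apply: val_inj; case: p => -[j w] pw; rewrite /= /plen take_size.
rewrite /cpa_one /nilp /pword /= size_drop subn_eq0.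
suff -> : (plen p <= k)%N = false by rewrite mulr0.
apply/negbTE; rewrite -ltnNge ltn_neqAle -ltnS ltn_ord andbT.
by apply: contraNneq kM => kE; apply/eqP/val_inj.
Qed.

Fact cpa_mulA : associative cpa_mul.
Proof.
move=> x y z; apply/funext => p; rewrite /cpa_mul.
pose F k m := x (pleft k p) * (y (pright k (pleft m p)) * z (pright m p)).
transitivity (\sum_(0 <= k < (plen p).+1) \sum_(k <= m < (plen p).+1) F k m).
  rewrite big_mkord; apply: eq_bigr => k _.
  have kp : (k <= plen p)%N by rewrite -ltnS.
  rewrite [RHS](_ : _ = \sum_(0 + k <= m < (plen p).+1) F k m) //.
  rewrite big_addn subSn // mulr_sumr.
  rewrite -(big_mkord xpredT (fun l => x (pleft k p) *
    (y (pleft l (pright k p)) * z (pright l (pright k p))))).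
  have -> : plen (pright k p) = (plen p - k)%N.
    by rewrite /plen /pword /= size_drop.
  apply: eq_bigr => l _; rewrite /F; congr (_ * (y _ * z _)); apply: val_inj.
    rewrite /= /ptgt /pword /= take_drop.
    by congr pair; rewrite /word_src take_takel // leq_addl.
  rewrite /= /ptgt /pword /= drop_drop.
  by congr pair; rewrite /word_src addnC takeD map_cat last_cat.
transitivity (\sum_(0 <= m < (plen p).+1) \sum_(0 <= k < m.+1) F k m).
  rewrite (eq_bigr (fun k => \sum_(0 <= m < (plen p).+1 | (k <= m)%N) F k m)).
    rewrite (exchange_big_dep_nat xpredT) //=; apply: eq_big_nat => m /andP[_ mp].
    by rewrite [RHS](big_nat_widen _ _ (plen p).+1).
  by move=> k _; rewrite (big_nat_widenl _ 0).
rewrite big_mkord; apply: eq_bigr => m _.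
have mp : (m <= plen p)%N by rewrite -ltnS.
have -> : plen (pleft m p) = m by rewrite /plen /pword /= size_takel.
rewrite big_mkord mulr_suml; apply: eq_bigr => k _.
rewrite /F mulrA; congr (x _ * _ * _); apply: val_inj.
by rewrite /= /ptgt /pword /= -take_min (minn_idPl _) // -ltnS.
Qed.

Fact cpa_mulDl : left_distributive cpa_mul +%R.
Proof.
move=> x y z; apply/funext => p; rewrite /cpa_mul -[RHS]/(_ p + _ p) -big_split.
by apply: eq_bigr => k _; apply: mulrDl.
Qed.

Fact cpa_mulDr : right_distributive cpa_mul +%R.
Proof.
move=> x y z; apply/funext => p; rewrite /cpa_mul -[RHS]/(_ p + _ p) -big_split.
by apply: eq_bigr => k _; apply: mulrDr.
Qed.

HB.instance Definition _ := GRing.Zmodule_isPzRing.Build cpa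
  cpa_mulA cpa_mul1r cpa_mulr1 cpa_mulDl cpa_mulDr.

Fact cpa_scalerAl (c : K) x y : c *: (x * y) = (c *: x) * y.
Proof.
apply/funext => p; rewrite -[LHS]/(c * cpa_mul x y p) mulr_sumr.
by apply: eq_bigr => k _; rewrite mulrA.
Qed.

Fact cpa_scalerAr (c : K) x y : c *: (x * y) = x * (c *: y).
Proof.
apply/funext => p; rewrite -[LHS]/(c * cpa_mul x y p) mulr_sumr.
by apply: eq_bigr => k _; rewrite mulrCA.
Qed.

End CompletePathAlgebra.

Section Ideals.
Variable R : pzRingType.

Definition two_sided_ideal (I : {pred R}) : Prop :=
  [/\ zmod_closed I, forall x y, y \in I -> x * y \in I
    & forall x y, x \in I -> x * y \in I].

Definition ideal_gen (G : R -> Prop) : {pred R} :=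
  fun x => `[< forall I : {pred R}, two_sided_ideal I ->
                 (forall y, G y -> y \in I) -> x \in I >].

Fact ideal_gen_ideal G : two_sided_ideal (ideal_gen G).
Proof.
split; first split.
- by apply/asboolP => I [[I0 _] _ _] _.
- move=> x y /asboolP Ix /asboolP Iy; apply/asboolP => I II GI.
  by case: (II) => [[_ IB] _ _]; apply: IB; [apply: Ix | apply: Iy].
- move=> x y /asboolP Iy; apply/asboolP => I II GI.
  by case: (II) => [_ Il _]; apply: Il; apply: Iy.
- move=> x y /asboolP Ix; apply/asboolP => I II GI.
  by case: (II) => [_ _ Ir]; apply: Ir; apply: Ix.
Qed.

End Ideals.

Section Jacobian.
Variables (Q : quiver) (K : fieldType).
Local Notation cpaQ := (cpa Q K).
Implicit Types (x y z : cpaQ) (p : qpath Q).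

(* Zero when w is not the word of a path with target j. *)
Definition path_elt (j : vert Q) (w : seq (arr Q)) : cpaQ :=
  fun p => (val p == (j, w))%:R.

Definition idem (i : vert Q) : cpaQ := path_elt i [::].

Definition cycle_elt (w : seq (arr Q)) : cpaQ :=
  if w is a :: _ then path_elt (tgt a) w else 0.

Definition coef x (j : vert Q) (w : seq (arr Q)) : K :=
  oapp x 0 (insub (j, w)).

(* The sum of a_{k+1} ... a_l a_1 ... a_{k-1} over the k with a_k = a, with
   indices shifted to start at 0. *)
Definition cyc_derivative_word (a : arr Q) l (c : l.-tuple (arr Q)) : cpaQ :=
  \sum_(k < l | tnth c k == a) path_elt (src a) (drop k.+1 c ++ take k c).

(* Linear continuous extension: the coefficient at p only receives
   contributions from the cyclic words of length plen p + 1. *)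
Definition cyc_derivative (a : arr Q) (W : cpaQ) : cpaQ :=
  fun p => \sum_(c : (plen p).+1.-tuple (arr Q) | cycle (@composable Q) c)
             coef W (tgt (thead c)) c * cyc_derivative_word a c p.

(* Closure in the topology of the powers of the arrow ideal. *)
Definition adic_closure (I : {pred cpaQ}) : {pred cpaQ} :=
  fun x => `[< forall n, exists2 y, y \in I &
                 forall p, (plen p < n)%N -> x p = y p >].

Fact cpa_mul_agree n x x' y y' :
  (forall p, (plen p < n)%N -> x p = x' p) ->
  (forall p, (plen p < n)%N -> y p = y' p) ->
  forall p, (plen p < n)%N -> (x * y) p = (x' * y') p.
Proof.
move=> xx' yy' p pn; apply: eq_bigr => k _; congr (_ * _).
  apply: xx'; apply: leq_ltn_trans pn.
  by rewrite /plen /pword /= size_take_min geq_minr.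
apply: yy'; apply: leq_ltn_trans pn.
by rewrite /plen /pword /= size_drop leq_subr.
Qed.

Fact adic_closure_ideal (I : {pred cpaQ}) :
  two_sided_ideal I -> two_sided_ideal (adic_closure I).
Proof.
move=> [[I0 IB] Il Ir]; split; first split.
- by apply/asboolP => n; exists 0.
- move=> x y /asboolP Ix /asboolP Iy; apply/asboolP => n.
  have [x' Ix' xx'] := Ix n; have [y' Iy' yy'] := Iy n.
  exists (x' - y'); first exact: IB.
  by move=> p pn; rewrite -[LHS]/(x p - y p) xx' ?yy'.
- move=> x y /asboolP Iy; apply/asboolP => n; have [y' Iy' yy'] := Iy n.
  by exists (x * y'); [apply: Il | apply: cpa_mul_agree].
- move=> x y /asboolP Ix; apply/asboolP => n; have [x' Ix' xx'] := Ix n.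
  by exists (x' * y); [apply: Ir | apply: cpa_mul_agree].
Qed.

Variable W : cpaQ.

Definition jacobian_ideal : {pred cpaQ} :=
  adic_closure (ideal_gen (fun x => exists a, x = cyc_derivative a W)).

Fact jacobian_ideal_ideal : two_sided_ideal jacobian_ideal.
Proof. exact/adic_closure_ideal/ideal_gen_ideal. Qed.

Fact jacobian_ideal_submod : subsemimod_closed jacobian_ideal.
Proof.
have [[I0 IB] Il _] := jacobian_ideal_ideal.
have IN x : x \in jacobian_ideal -> - x \in jacobian_ideal.
  by move=> Ix; rewrite -sub0r IB.
split; first split=> //.
  by move=> x y Ix Iy; rewrite -[y]opprK; apply: IB => //; apply: IN.
by move=> c x Ix; rewrite -[x]mul1r cpa_scalerAl; apply: Il.
Qed.

HB.instance Definition _ :=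
  GRing.isSubmodClosed.Build K cpaQ jacobian_ideal jacobian_ideal_submod.

Definition jacobian := quotmod jacobian_ideal.

HB.instance Definition _ := GRing.Lmodule.on jacobian.
HB.instance Definition _ := EqQuotient.copy jacobian (quotmod jacobian_ideal).

Definition jac_pi (x : cpaQ) : jacobian := \pi_jacobian x.

Definition jac_one : jacobian := jac_pi 1.
Definition jac_mul (u v : jacobian) : jacobian := jac_pi (repr u * repr v).

Fact jac_piD x y : jac_pi (x + y) = jac_pi x + jac_pi y.
Proof. exact: quotmod_piD. Qed.

Fact jac_piM x y : jac_mul (jac_pi x) (jac_pi y) = jac_pi (x * y).
Proof.
have [[I0 IB] Il Ir] := jacobian_ideal_ideal.
have piE z : repr (jac_pi z) - z \in jacobian_ideal.
  by rewrite -[_ \in _]quotmod_pi_eq reprK.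
apply/eqP; rewrite [_ == _]quotmod_pi_eq.
set x' := repr _; set y' := repr _.
rewrite -[_ \in _]/(_ \in jacobian_ideal).
have -> : x' * y' - x * y = x' * (y' - y) - (x - x') * y.
  by rewrite mulrBr mulrBl opprB addrA subrK.
apply: (IB); first exact/Il/piE.
by apply: Ir; rewrite -opprB -sub0r; apply: IB => //; apply: piE.
Qed.

Fact jac_piP (u : jacobian) : exists x, u = jac_pi x.
Proof. by exists (repr u); rewrite /jac_pi reprK. Qed.

Fact jac_mulA : associative jac_mul.
Proof.
move=> u v w.
have [[x ->] [y ->] [z ->]] := And3 (jac_piP u) (jac_piP v) (jac_piP w).
by rewrite (jac_piM y) (jac_piM x y) (jac_piM x) (jac_piM (x * y)) mulrA.
Qed.

Fact jac_mul1r : left_id jac_one jac_mul.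
Proof.
by move=> u; have [x ->] := jac_piP u; rewrite (jac_piM 1) mul1r.
Qed.

Fact jac_mulr1 : right_id jac_one jac_mul.
Proof.
by move=> u; have [x ->] := jac_piP u; rewrite (jac_piM x 1) mulr1.
Qed.

Fact jac_mulDl : left_distributive jac_mul +%R.
Proof.
move=> u v w.
have [[x ->] [y ->] [z ->]] := And3 (jac_piP u) (jac_piP v) (jac_piP w).
by rewrite -jac_piD (jac_piM (x + y)) (jac_piM x) (jac_piM y) mulrDl jac_piD.
Qed.

Fact jac_mulDr : right_distributive jac_mul +%R.
Proof.
move=> u v w.
have [[x ->] [y ->] [z ->]] := And3 (jac_piP u) (jac_piP v) (jac_piP w).
rewrite -jac_piD (jac_piM x (y + z)) (jac_piM x y) (jac_piM x z) mulrDr.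
by rewrite jac_piD.
Qed.

HB.instance Definition _ := GRing.Zmodule_isPzRing.Build jacobian
  jac_mulA jac_mul1r jac_mulr1 jac_mulDl jac_mulDr.

(* The Jacobian algebra may be zero for a general W, so the algebra structures
   of the library, which require 1 != 0, do not apply. *)
Fact jac_scalerAl (c : K) (u v : jacobian) : c *: (u * v) = (c *: u) * v.
Proof.
have [[x ->] [y ->]] := conj (jac_piP u) (jac_piP v).
have sE z : c *: jac_pi z = jac_pi (c *: z) by exact: quotmod_pi_scale.
have mE : forall z t, jac_pi z * jac_pi t = jac_pi (z * t) by exact: jac_piM.
by rewrite mE !sE mE cpa_scalerAl.
Qed.

Fact jac_scalerAr (c : K) (u v : jacobian) : c *: (u * v) = u * (c *: v).
Proof.
have [[x ->] [y ->]] := conj (jac_piP u) (jac_piP v).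
have sE z : c *: jac_pi z = jac_pi (c *: z) by exact: quotmod_pi_scale.
have mE : forall z t, jac_pi z * jac_pi t = jac_pi (z * t) by exact: jac_piM.
by rewrite mE !sE mE cpa_scalerAr.
Qed.

Variable i : vert Q.

Definition proj_pred : {pred jacobian^o} :=
  fun u => `[< exists v : jacobian, u = v * jac_pi (idem i) >].

Fact proj_pred_closed : subsemimod_closed proj_pred.
Proof.
split; first split.
- by apply/asboolP; exists 0; rewrite mul0r.
- move=> _ _ /asboolP[u ->] /asboolP[v ->].
  by apply/asboolP; exists (u + v); rewrite mulrDl.
- move=> c _ /asboolP[u ->]; apply/asboolP; exists (c * u).
  by rewrite -[LHS]/(c * (u * _)) mulrA.
Qed.

HB.instance Definition _ :=
  GRing.isSubmodClosed.Build jacobian jacobian^o proj_pred proj_pred_closed.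

Definition proj_mod : Type := {u : jacobian^o | proj_pred u}.

HB.instance Definition _ := [isSub of proj_mod for sval].
HB.instance Definition _ := Choice.copy proj_mod {u : jacobian^o | proj_pred u}.
HB.instance Definition _ := GRing.SubChoice_isSubLmodule.Build
  jacobian jacobian^o proj_pred proj_mod proj_pred_closed.

Definition simple_mod := top proj_mod.
HB.instance Definition _ := GRing.Lmodule.on simple_mod.

End Jacobian.

Section Gluing.
Variables (Q Q' : quiver) (a : arr Q) (b : arr Q').

(* The quiver obtained from the disjoint union of Q and Q' by identifying a
   with b, src a with src b and tgt a with tgt b. The identified vertices and
   arrow are represented in Q. Only meant for src b <> tgt b. *)
Definition glue_vert : finType :=
  (vert Q + {v : vert Q' | v \notin [:: src b; tgt b]})%type.
Definition glue_arr : finType := (arr Q + {e : arr Q' | e != b})%type.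

Definition glue_inr_vert (v : vert Q') : glue_vert :=
  match insub v with
  | Some u => inr u
  | None => inl (if v == src b then src a else tgt a)
  end.

Definition glue_inr_arr (e : arr Q') : glue_arr :=
  match insub e with Some u => inr u | None => inl a end.

Definition glue : quiver :=
  @Quiver glue_vert glue_arr
    (fun e => match e with
              | inl e => inl (src e)
              | inr e => glue_inr_vert (src (val e))
              end)
    (fun e => match e with
              | inl e => inl (tgt e)
              | inr e => glue_inr_vert (tgt (val e))
              end).

End Gluing.

(* The oriented cycle with n vertices: the arrow i goes from i + 1 to i, so
   that enum 'I_n is the word of a cyclic path. *)
Definition cycle_quiver (n : nat) : quiver :=
  @Quiver 'I_n 'I_n (fun i => ordS i) (fun i => i).

Record quiver_iso (Q Q' : quiver) := QuiverIso {
  iso_vert : vert Q -> vert Q';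
  iso_arr : arr Q -> arr Q';
  iso_vert_bij : bijective iso_vert;
  iso_arr_bij : bijective iso_arr;
  iso_src : forall e, src (iso_arr e) = iso_vert (src e);
  iso_tgt : forall e, tgt (iso_arr e) = iso_vert (tgt e)
}.

(* polygon_tree Q U ws: up to isomorphism, Q is obtained by the gluing
   procedure, U is the set of arrows used for a gluing, and ws consists of the
   words of the cycles Q_0, ..., Q_N, each with an arbitrary starting point. *)
Inductive polygon_tree :
    forall Q : quiver, {set arr Q} -> seq (seq (arr Q)) -> Prop :=
| PolygonTreeCycle (n k : nat) :
    (3 <= n)%N ->
    @polygon_tree (cycle_quiver n) set0 [:: rot k (enum 'I_n)]
| PolygonTreeGlue (Q : quiver) (U : {set arr Q}) (ws : seq (seq (arr Q)))
    (n k : nat) (a : arr Q) (b : arr (cycle_quiver n)) :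
    polygon_tree U ws -> (3 <= n)%N -> a \notin U ->
    @polygon_tree (glue a b)
      [set inl e | e in a |: U]
      (rcons [seq [seq inl e | e <- w] | w <- ws]
        [seq glue_inr_arr a b e | e <- rot k (enum 'I_n)])
| PolygonTreeIso (Q Q' : quiver) (f : quiver_iso Q Q') (U : {set arr Q})
    (ws : seq (seq (arr Q))) :
    polygon_tree U ws ->
    polygon_tree [set iso_arr f e | e in U]
      [seq [seq iso_arr f e | e <- w] | w <- ws].

Definition polygon_tree_qp (Q : quiver) (K : fieldType) (W : cpa Q K) : Prop :=
  exists (U : {set arr Q}) (ws : seq (seq (arr Q))),
    polygon_tree U ws /\ W = \sum_(w <- ws) cycle_elt K w.

Definition finite_dimensional (K : fieldType) (A : lmodType K) : Prop :=
  exists n, inhabited (Vector.axiom n A).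

Definition embeds_in_rad (R : pzRingType) (S P : lmodType R) : Prop :=
  exists f : {linear S -> P}, injective f /\ forall x, f x \in rad P.

(* Main.v *)
From mathcomp Require Import all_boot all_order all_algebra.
From mathcomp Require Import boolp.
Require Import Defs.

Set Implicit Arguments.
Unset Strict Implicit.
Unset Printing Implicit Defensive.

Import GRing.Theory.
Local Open Scope ring_scope.

(** Every closed path of positive length vanishes in the Jacobian algebra.
    This is shown by induction on the number of polygons, together with the
    fact that a path parallel to an unglued arrow e evaluates to an integer
    multiple of e. When a polygon is glued along a, the relation at a says that
    the rest q of the new polygon equals minus the path p completing a to a
    cycle in the old quiver, so that passages through q can be moved back to
    the old quiver; a closed path based at a new vertex of q then runs through
    a whole polygon, i.e. contains an arrow times its own cyclic derivative.
    Consequently a path with at least as many arrows as there are vertices is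
    zero, which gives finite dimension, and e_i A e_i = K e_i. The image x in
    rad P_i of the generator of S_i would satisfy e_i x = x, hence be a multiple
    of e_i; but rad P_i lies in the maximal submodule of elements with zero
    coefficient at e_i, so x = 0. *)

(** * Words, paths and relations *)

Section Cut.
Variable T : eqType.
Implicit Types (x : T) (w u : seq T).

(** This is the cyclic derivative of the cyclic word [w] at a letter [x] that occurs once: what
    follows [x], read round to just before it. *)
Definition cut x w := behead (rot (index x w) w).

Lemma cutE x w : x \in w ->
  cut x w = drop (index x w).+1 w ++ take (index x w) w.
Proof. by move=> xw; rewrite /cut rot_index. Qed.

Lemma cut_rot_eq x w u k : uniq w -> rot k w = x :: u -> cut x w = u.
Proof.
(* An oversized [k] rotates trivially and may be replaced by 0; otherwise [x] stands at position
   [k], which uniqueness identifies with its index. *)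
move=> Uw wE; wlog kw : k wE / (k < size w)%N.
  move=> H; case: (ltnP k (size w)) => [|wk]; first exact: H.
  apply: (H 0%N); first by rewrite rot0 -wE rot_oversize.
  by rewrite -(size_rot k) wE.
rewrite /cut; suff -> : index x w = k by rewrite wE.
have <- : nth x w k = x; last by rewrite index_uniq.
have := congr1 (head x) wE; rewrite /rot (drop_nth x) //=.
Qed.

Lemma cut_rot x w k : uniq w -> x \in w -> cut x (rot k w) = cut x w.
Proof.
move=> Uw xw; have [i u rE] := rot_to xw.
have /rot_to[j v E] : x \in rot k w by rewrite mem_rot.
have Ukw : uniq (rot k w) by rewrite rot_uniq.
rewrite (cut_rot_eq Ukw E) (cut_rot_eq Uw rE); move: E.
by rewrite rot_rot_add => /(cut_rot_eq Uw); rewrite (cut_rot_eq Uw rE).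
Qed.

Lemma cut_cat x u1 u2 : uniq (u1 ++ x :: u2) ->
  cut x (u1 ++ x :: u2) = u2 ++ u1.
Proof.
by move=> U; apply: (@cut_rot_eq _ _ _ (size u1)) => //; rewrite rot_size_cat.
Qed.

End Cut.

Lemma cut_map (T T' : eqType) (f : T -> T') x (w : seq T) : injective f ->
  cut (f x) (map f w) = map f (cut x w).
Proof. by move=> fI; rewrite /cut index_map // -map_rot behead_map. Qed.

Section PathsBetween.
Variable Q : quiver.
Implicit Types (x y z : vert Q) (e : arr Q) (u w : seq (arr Q)).

(** Source first, target second: the head of [w] ends at [y], since words compose like functions. *)
Definition path_between x y w := is_path y w && (word_src y w == x).

Lemma path_between_nil x y : path_between x y [::] = (x == y).
Proof. by rewrite /path_between /= eq_sym. Qed.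

Lemma path_between_cons x y e w :
  path_between x y (e :: w) = (tgt e == y) && path_between x (src e) w.
Proof.
rewrite /path_between /word_src /= -andbA; congr (_ && (_ && _)).
by case: w => //= b w; rewrite /composable eq_sym.
Qed.

Lemma path_between_cat x y u w : path_between x y (u ++ w) =
  path_between (word_src y u) y u && path_between x (word_src y u) w.
Proof.
elim: u y => [|e u IH] y /=; first by rewrite path_between_nil eqxx.
rewrite !path_between_cons -andbA IH; congr andb; rewrite /word_src /=.
Qed.

Lemma cat_path_between x y z u w :
  path_between z y u -> path_between x z w -> path_between x y (u ++ w).
Proof.
move=> yu zw; rewrite path_between_cat.
by case/andP: (yu) => _ /eqP ->; rewrite yu.
Qed.

Lemma path_between_cut e w : uniq w -> cycle (@composable Q) w -> e \in w ->
  path_between (tgt e) (src e) (cut e w).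
Proof.
move=> Uw cw ew; have [k u wE] := rot_to ew.
rewrite (cut_rot_eq Uw wE); move: cw; rewrite -(rot_cycle k) wE /=.
(* The letter preceding [u] and the letter closing the cycle are generalised separately; only the
   former moves in the induction. *)
elim: u {wE} e {1 4}e {ew} => [|d u IH] e f /=.
  by rewrite path_between_nil andbT /composable eq_sym.
by case/andP=> ed /IH du; rewrite path_between_cons du -(eqP ed) eqxx.
Qed.

End PathsBetween.

Section Relations.
Variables (Q : quiver) (A : pzRingType) (phi : arr Q -> A).
Implicit Types (U : {set arr Q}) (ws : seq (seq (arr Q))) (e : arr Q).

Definition ev w := \prod_(e <- w) phi e.

Definition ev_der ws e := \sum_(w <- ws | e \in w) ev (cut e w).

(* Weaker than the Jacobian relations at the arrows outside U: it passes from
   a polygon-tree to the ones that it was glued from. *)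
Definition relations U ws :=
  (forall e, e \in U -> ev_der ws e = 0) /\
  (forall e, phi e * ev_der ws e = 0 /\ ev_der ws e * phi e = 0).

Lemma ev_nil : ev [::] = 1. Proof. exact: big_nil. Qed.
Lemma ev_cons e w : ev (e :: w) = phi e * ev w. Proof. exact: big_cons. Qed.
Lemma ev_cat u w : ev (u ++ w) = ev u * ev w. Proof. exact: big_cat. Qed.

Lemma ev_seq1 e : ev [:: e] = phi e. Proof. exact: big_seq1. Qed.

End Relations.

Lemma ev_map (Q G : quiver) (ia : arr Q -> arr G) (A : pzRingType)
  (phi : arr G -> A) w : ev phi (map ia w) = ev (phi \o ia) w.
Proof. exact: big_map. Qed.

Lemma ev_der_map (Q G : quiver) (ia : arr Q -> arr G) (A : pzRingType)
    (phi : arr G -> A) ws e : injective ia ->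
  ev_der phi [seq map ia w | w <- ws] (ia e) = ev_der (phi \o ia) ws e.
Proof.
move=> iaI; rewrite /ev_der big_map.
by apply: eq_big => [w|w _]; rewrite ?mem_map // cut_map // ev_map.
Qed.

(** The invariant of the induction on polygons. The last two fields range over all rings and all
    [phi] with the weak [relations]: after a gluing, the old quiver is evaluated by a restriction of
    [phi], for which the derivative at the glued arrow need not vanish. *)
Record tree_spec (Q : quiver) (U : {set arr Q}) (ws : seq (seq (arr Q))) :
    Prop := TreeSpec {
  tree_cycles : forall w, w \in ws ->
    [/\ uniq w, cycle (@composable Q) w & (1 < size w)%N];
  tree_unglued : forall e, e \notin U ->
    exists w, [seq w <- ws | e \in w] = [:: w];
  tree_closed : forall (A : pzRingType) (phi : arr Q -> A),
    relations phi U ws -> forall v w, w != [::] -> path_between v v w ->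
    ev phi w = 0;
  tree_parallel : forall (A : pzRingType) (phi : arr Q -> A),
    relations phi U ws -> forall e w, e \notin U ->
    path_between (src e) (tgt e) w -> exists c : int, ev phi w = phi e *~ c
}.

(** * Transport along quiver isomorphisms *)

Section Iso.
Variables (Q Q' : quiver) (f : quiver_iso Q Q').

Lemma tree_spec_iso (U : {set arr Q}) ws : tree_spec U ws ->
  tree_spec [set iso_arr f e | e in U] [seq map (iso_arr f) w | w <- ws].
Proof.
case=> cyc ung clo par.
have fI : injective (iso_arr f) := bij_inj (iso_arr_bij f).
have vI : injective (iso_vert f) := bij_inj (iso_vert_bij f).
have [g gK fK] := iso_arr_bij f; have [h hK vK] := iso_vert_bij f.
have pathE x y w : path_between (iso_vert f x) (iso_vert f y)
    (map (iso_arr f) w) = path_between x y w.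
  elim: w y => [|e w IH] y; first by rewrite !path_between_nil (inj_eq vI).
  by rewrite /= !path_between_cons iso_tgt iso_src IH (inj_eq vI).
have memU e : (iso_arr f e \in [set iso_arr f e | e in U]) = (e \in U).
  exact: mem_imset.
have relE (A : pzRingType) (phi : arr Q' -> A) :
    relations phi [set iso_arr f e | e in U] [seq map (iso_arr f) w | w <- ws] ->
    relations (phi \o iso_arr f) U ws.
  case=> r0 r1; split=> e; rewrite -ev_der_map //; last exact: r1.
  by move=> eU; apply: r0; rewrite memU.
split.
- move=> _ /mapP[w /cyc[Uw cw sw] ->]; rewrite map_inj_uniq // size_map.
  split=> //; rewrite cycle_map (eq_cycle (e' := @composable Q)) // => d e /=.
  by rewrite /composable iso_src iso_tgt (inj_eq vI).
- move=> e'; rewrite -[e']fK memU => /ung[w wE]; exists (map (iso_arr f) w).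
  rewrite filter_map -[RHS]/(map (map (iso_arr f)) [:: w]) -wE; congr map.
  by apply: eq_filter => u /=; rewrite mem_map.
- move=> A phi /relE rphi v' w' w0.
  rewrite -[v']vK -[w'](mapK fK) pathE ev_map; apply: clo => //.
  by case: w' w0.
- move=> A phi /relE rphi e' w'; rewrite -[e']fK memU -[w'](mapK fK).
  by rewrite iso_src iso_tgt pathE ev_map; apply: par.
Qed.

End Iso.

(** * Gluing a polygon *)

Section Ear.
(** Gluing in abstract form: [G] is an embedded copy of [Q] with an ear [q], a path from the target
    of [a] to its source. The ear is indexed from its end, so [q_ 0] ends at the source of [a], and
    the targets of the later [q_ i] are the new vertices. *)
Variables (Q G : quiver) (iv : vert Q -> vert G) (ia : arr Q -> arr G).
Variables (a : arr Q) (q : seq (arr G)).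
Local Notation q_ i := (nth (ia a) q i).
Hypotheses (iv_inj : injective iv) (ia_inj : injective ia).
Hypothesis ia_src : forall e, src (ia e) = iv (src e).
Hypothesis ia_tgt : forall e, tgt (ia e) = iv (tgt e).
Hypothesis ia_notin : forall e, ia e \notin q.
Hypothesis arrG : forall x, x \notin q -> exists e, x = ia e.
Hypotheses (q_uniq : uniq q) (q_size : (1 < size q)%N).
Hypothesis q_path : path_between (iv (tgt a)) (iv (src a)) q.
Hypothesis q_inner : forall i v, (0 < i < size q)%N -> tgt (q_ i) <> iv v.
Hypothesis q_inj : forall i j, (i < size q)%N -> (j < size q)%N ->
  tgt (q_ i) = tgt (q_ j) -> i = j.
Hypothesis vertG : forall y,
  (exists v, y = iv v) \/ (exists2 i, (0 < i < size q)%N & y = tgt (q_ i)).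

Lemma arr_earP x :
  (exists e, x = ia e) \/ (exists2 i, (i < size q)%N & x = q_ i).
Proof.
case: (boolP (x \in q)) => [xq|/arrG]; last by left.
by right; exists (index x q); rewrite ?index_mem ?nth_index.
Qed.

Lemma ear_path_drop i : (i < size q)%N ->
  path_between (iv (tgt a)) (tgt (q_ i)) (drop i q) /\
  path_between (iv (tgt a)) (src (q_ i)) (drop i.+1 q).
Proof.
move=> iq; have := q_path; rewrite -{1}(cat_take_drop i q) path_between_cat.
case/andP=> _; rewrite (drop_nth (ia a) iq) !path_between_cons.
by case/andP=> _ ->; rewrite eqxx.
Qed.

Lemma ear_tgt0 : tgt (q_ 0) = iv (src a).
Proof.
by case: q q_size q_path => // x s _; rewrite path_between_cons => /andP[/eqP].
Qed.

Lemma ear_src i : (i.+1 < size q)%N -> src (q_ i) = tgt (q_ i.+1).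
Proof.
move=> iq; have [_] := ear_path_drop (ltnW iq).
by rewrite (drop_nth (ia a) iq) path_between_cons => /andP[/eqP].
Qed.

Lemma ear_src_last i : i.+1 = size q -> src (q_ i) = iv (tgt a).
Proof.
move=> iq; have [|_] := @ear_path_drop i; first by rewrite -iq.
by rewrite iq drop_size path_between_nil => /eqP.
Qed.

(** Inner vertices are new and pairwise distinct, so each is left by a single ear arrow, the
    preceding letter of [q]. *)
Lemma ear_src_inner i j : (i < size q)%N -> (0 < j < size q)%N ->
  src (q_ i) = tgt (q_ j) -> i.+1 = j.
Proof.
move=> iq jq; have [jp js] := andP jq.
case: (ltngtP i.+1 (size q)) => [iq'|/leq_trans/(_ iq)|iq'].
- by rewrite ear_src // => /q_inj; apply.
- by rewrite ltnn.
- by rewrite ear_src_last // => /esym/q_inner.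
Qed.

(** All other ear arrows start at inner vertices; thus the ear can only be entered at the target of
    [a]. *)
Lemma ear_src_old i v : (i < size q)%N -> src (q_ i) = iv v ->
  i.+1 = size q /\ v = tgt a.
Proof.
move=> iq; case: (ltngtP i.+1 (size q)) => [iq'|/leq_trans/(_ iq)|iq'].
- by rewrite ear_src // => /q_inner[].
- by rewrite ltnn.
- by rewrite ear_src_last // => /iv_inj.
Qed.

Section Evaluation.
Variables (A : pzRingType) (phi : arr G -> A) (p : seq (arr Q)).
Local Notation phiQ := (phi \o ia).
Hypotheses (p_path : path_between (tgt a) (src a) p) (p0 : p != [::]).
Hypothesis q_ev : ev phi q = - ev phiQ p.

(* Each complete passage through q can be replaced by p, up to sign. *)
Lemma ev_from_old x y w : path_between (iv x) y w ->
  (exists v c w', [/\ y = iv v, path_between x v w', w' == [::] -> w = [::]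
     & ev phi w = ev phiQ w' *~ c]) \/
  (exists i c w', [/\ (0 < i < size q)%N, y = tgt (q_ i),
     path_between x (tgt a) w' & ev phi w = ev phi (drop i q) * ev phiQ w' *~ c]).
Proof.
elim: w y => [|e w IH] y.
  rewrite path_between_nil => /eqP <-; left; exists x, 1, [::].
  by rewrite path_between_nil !ev_nil.
rewrite path_between_cons => /andP[/eqP <-{y} /IH].
case: (arr_earP e) => [[d ->]|[j jq ->]].
  rewrite ia_src ia_tgt => -[[v [c [w' [/iv_inj <- xw _ wE]]]]|]; last first.
    by case=> i [c [w' [iq /esym/q_inner[]]]].
  left; exists (tgt d), c, (d :: w').
  by rewrite path_between_cons eqxx xw !ev_cons wE mulrzAr.
(* An ear arrow after an old vertex enters the ear, so it is the last letter of [q]. *)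
case=> [[v [c [w' [jv xw _ wE]]]]|[i [c [w' [iq ji xw wE]]]]].
  have [js vE] := ear_src_old jq jv; right; exists j, c, w'; split=> //.
  - by rewrite jq andbT; move: q_size; rewrite -js.
  - by rewrite -vE.
  - by rewrite ev_cons wE (drop_nth (ia a) jq) js drop_size ev_seq1 mulrzAr.
have {}ji := ear_src_inner jq iq ji; rewrite -{i}ji in iq wE.
have wjE : ev phi (q_ j :: w) = ev phi (drop j q) * ev phiQ w' *~ c.
  by rewrite (drop_nth (ia a) jq) !ev_cons wE mulrzAr mulrA.
(* For [j = 0] the passage through the ear is complete, and [p] replaces [q] at the cost of a sign;
   otherwise the path is still inside the ear. *)
case: j jq iq wE wjE => [|j] jq iq wE wjE; last first.
  by right; exists j.+1, c, w'; rewrite jq.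
left; exists (src a), (- c), (p ++ w'); split.
- exact: ear_tgt0.
- exact: cat_path_between xw.
- by case: p p0.
- by rewrite wjE drop0 q_ev ev_cat mulNr mulrNz mulNrz.
Qed.

(** From an inner vertex the only way on is along the ear. A path either stops inside it or first
    runs through all the remaining arrows [take i q]. *)
Lemma path_from_inner i y w : (0 < i < size q)%N ->
  path_between (tgt (q_ i)) y w ->
  (exists2 j, (0 < j <= i)%N & y = tgt (q_ j) /\ w = drop j (take i q)) \/
  (exists2 w', path_between (iv (src a)) y w' & w = w' ++ take i q).
Proof.
move=> iq; have [i0 iS] := andP iq; have si := size_takel (ltnW iS).
elim: w y => [|e w IH] y.
  rewrite path_between_nil => /eqP <-; left; exists i; first by rewrite i0 leqnn.
  by rewrite drop_oversize // si.
rewrite path_between_cons => /andP[/eqP <-{y} /IH].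
case=> [[j /andP[j0 ji] [ej wE]]|[w' xw wE]]; last first.
  by right; exists (e :: w'); rewrite ?path_between_cons ?eqxx ?xw // wE.
have js : (0 < j < size q)%N by rewrite j0 (leq_ltn_trans ji).
case: (arr_earP e) ej => [[d ->]|[k kq ->]].
  by rewrite ia_src => /esym/q_inner[].
move/(ear_src_inner kq js) => kj; rewrite -{j}kj in j0 ji wE js.
have kE : q_ k :: w = drop k (take i q).
  by rewrite wE (@drop_nth _ (ia a) k) ?si // nth_take.
case: k kq j0 ji wE js kE => [|k] kq j0 ji wE js kE.
  right; exists [::]; first by rewrite path_between_nil ear_tgt0.
  by rewrite kE drop0.
by left; exists k.+1; rewrite ?(ltnW ji).
Qed.

End Evaluation.

(** * The invariant after gluing an ear *)

Variables (U : {set arr Q}) (ws : seq (seq (arr Q))).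
Variables (wa : seq (arr G)) (k : nat).
Hypotheses (spec : tree_spec U ws) (aU : a \notin U).
Hypothesis waE : rot k wa = ia a :: q.
Local Notation UG := [set ia e | e in a |: U].
Local Notation wsG := (rcons [seq map ia w | w <- ws] wa).

Lemma mem_wa x : (x \in wa) = (x == ia a) || (x \in q).
Proof. by rewrite -(mem_rot k) waE inE. Qed.

Lemma wa_uniq : uniq wa.
Proof. by rewrite -(rot_uniq k) waE /= ia_notin. Qed.

Lemma ia_mem_wa e : (ia e \in wa) = (e == a).
Proof. by rewrite mem_wa (negbTE (ia_notin e)) orbF (inj_eq ia_inj). Qed.

Lemma mem_UG e : (ia e \in UG) = (e == a) || (e \in U).
Proof. by rewrite mem_imset // !inE. Qed.

Lemma ear_notin_old e w : e \in q -> e \notin map ia w.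
Proof.
by apply: contraL => /mapP[d _ ->].
Qed.

(** Among old arrows the new cycle contains only [a], and cutting it there leaves [q]. *)
Lemma ev_der_old (A : pzRingType) (phi : arr G -> A) e :
  ev_der phi wsG (ia e) =
  ev_der (phi \o ia) ws e + (if e == a then ev phi q else 0).
Proof.
rewrite /ev_der -cats1 big_cat /= -[in LHS]/(ev_der _ _ _) ev_der_map //.
congr (_ + _); rewrite big_cons big_nil ia_mem_wa; case: eqP => // ->.
by rewrite (cut_rot_eq wa_uniq waE) addr0.
Qed.

Lemma ev_der_ear (A : pzRingType) (phi : arr G -> A) i : (i < size q)%N ->
  ev_der phi wsG (q_ i) =
  ev phi (drop i.+1 q) * (phi (ia a) * ev phi (take i q)).
Proof.
move=> iq; have qi : q_ i \in q by rewrite mem_nth.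
rewrite /ev_der -cats1 big_cat /= big_map big_pred0 => [|w]; last first.
  exact/negbTE/ear_notin_old.
rewrite add0r big_cons big_nil mem_wa qi orbT addr0 -ev_cons -ev_cat.
congr (ev _ _); rewrite -(cut_rot k) ?wa_uniq ?mem_wa ?qi ?orbT // waE.
have E : ia a :: q = (ia a :: take i q) ++ q_ i :: drop i.+1 q.
  by rewrite /= -drop_nth // cat_take_drop.
by rewrite E cut_cat // -E /= ia_notin.
Qed.

(** The relation at the newly glued [a] says that its old derivative is [- q]. This need not vanish,
    but its products with [a] do, by the relations at the two end arrows of the ear; this is what
    the weak form of [relations] asks for. *)
Lemma relations_old (A : pzRingType) (phi : arr G -> A) :
  relations phi UG wsG ->
  relations (phi \o ia) U ws /\ ev_der (phi \o ia) ws a = - ev phi q.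
Proof.
case=> r0 r1; have Da : ev_der (phi \o ia) ws a = - ev phi q.
  apply/eqP; rewrite -addr_eq0; have := ev_der_old phi a.
  by rewrite eqxx r0 ?mem_UG ?eqxx // => <-.
have szq := ltnW q_size.
(* The derivative at the last letter of [q] is [a] times the other letters; multiplying it by that
   letter on the right gives [a q]. *)
have aq : phi (ia a) * ev phi q = 0.
  have lq : ((size q).-1 < size q)%N by rewrite prednK.
  have [_] := r1 (q_ (size q).-1); rewrite ev_der_ear // prednK //.
  rewrite drop_size ev_nil mul1r -mulrA -[phi (q_ _)]ev_seq1 -ev_cat.
  by rewrite cats1 -take_nth // prednK // take_size.
(* Symmetrically, the first letter of [q] times its derivative is [q a]. *)
have qa : ev phi q * phi (ia a) = 0.
  have [+ _] := r1 (q_ 0); rewrite ev_der_ear // take0 ev_nil mulr1 mulrA.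
  by rewrite -ev_cons -drop_nth // drop0.
split=> //; split=> e; first last.
  case: (eqVneq e a) => [->|ea]; first by rewrite Da mulrN mulNr /= aq qa oppr0.
  by have := r1 (ia e); rewrite ev_der_old (negbTE ea) addr0.
move=> eU; have ea : e == a = false by apply: contraNF aU => /eqP <-.
by have := r0 (ia e); rewrite mem_UG eU orbT ev_der_old ea addr0; apply.
Qed.

(** Exactly one cycle runs through an unglued arrow, so the derivative there is a single path,
    independent of the ring and of [phi]. *)
Lemma cofactor_path : exists p, [/\ path_between (tgt a) (src a) p, p != [::] &
  forall (A : pzRingType) (phi : arr Q -> A), ev_der phi ws a = ev phi p].
Proof.
have [w wE] := tree_unglued spec aU.
have : w \in [seq w <- ws | a \in w] by rewrite wE inE.
rewrite mem_filter => /andP[aw /(tree_cycles spec)[Uw cw sw]].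
exists (cut a w); split.
- exact: path_between_cut.
- by rewrite -size_eq0 size_behead size_rot; case: (size w) sw => [|[]].
- by move=> A phi; rewrite /ev_der -big_filter wE big_seq1.
Qed.

Lemma wa_cycle : cycle (@composable G) wa.
Proof.
rewrite -(rot_cycle k) waE /= -cats1.
have : path_between (iv (src a)) (iv (tgt a)) (ia a :: q ++ [:: ia a]).
  rewrite path_between_cons ia_tgt eqxx ia_src; apply: cat_path_between q_path _.
  by rewrite path_between_cons path_between_nil ia_tgt ia_src !eqxx.
by case/andP=> /andP[].
Qed.

(** A closed path at an old vertex is a multiple of a nonempty old closed path. At an inner vertex
    it has to go round the whole new polygon. *)
Lemma ear_closed (A : pzRingType) (phi : arr G -> A) : relations phi UG wsG ->
  forall v w, w != [::] -> path_between v v w -> ev phi w = 0.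
Proof.
move=> rphi v w w0 vw; have [p [pp p0 pE]] := cofactor_path.
have [rQ Da] := relations_old rphi.
have qE : ev phi q = - ev (phi \o ia) p by rewrite -pE Da opprK.
have old := ev_from_old pp p0 qE.
case: (vertG v) vw => [[x ->]|[i iq ->]] vw.
  case: (old _ _ _ vw) => [[y [c [w' [/iv_inj <- xw w'0 ->]]]]|]; last first.
    by case=> j [c [w' [jq /esym/q_inner[]]]].
  rewrite (tree_closed spec rQ _ xw) ?mul0rz //.
  by apply: contraNneq w0 => /eqP/w'0 ->.
have [i0 iS] := andP iq.
(* If the path stays in the ear, closedness forces [j = i], and the path is empty. *)
case: (path_from_inner iq vw) => [[j /andP[j0 ji] [/q_inj ij wE]]|[u xu wE]].
  move: w0; rewrite wE -(ij iS (leq_ltn_trans ji iS)).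
  by rewrite drop_oversize // size_takel // ltnW.
case: (old _ _ _ xu) => [[y [c [w' [/q_inner[]]]]]|] //.
case=> j [c [w' [/andP[_ jS] /(q_inj iS)-/(_ jS) <- xw uE]]].
(* The part in the old quiver is parallel to [a], hence a multiple of [a]; the whole path becomes a
   multiple of [q_ i] times the derivative at [q_ i], which is zero. *)
have [c' w'E] := tree_parallel spec rQ aU xw.
have [r _] := rphi.2 (q_ i); move: r; rewrite ev_der_ear // mulrA -ev_cons.
rewrite -drop_nth // wE ev_cat uE w'E mulrzAr -mulrzA mulrzAl -mulrA => ->.
by rewrite mul0rz.
Qed.

(** For an old arrow the path is first moved back to the old quiver. An ear arrow has an inner end,
    where no other arrow passes in the same direction, so a parallel path is that arrow times a
    closed path and the multiple is 0 or 1. *)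
Lemma ear_parallel (A : pzRingType) (phi : arr G -> A) : relations phi UG wsG ->
  forall e w, e \notin UG -> path_between (src e) (tgt e) w ->
  exists c : int, ev phi w = phi e *~ c.
Proof.
move=> rphi e w eU ew; have [p [pp p0 pE]] := cofactor_path.
have [rQ Da] := relations_old rphi.
have qE : ev phi q = - ev (phi \o ia) p by rewrite -pE Da opprK.
case: (arr_earP e) eU ew => [[d ->]|[i iq ->]].
  rewrite mem_UG negb_or ia_src ia_tgt => /andP[_ dU] dw.
  case: (ev_from_old pp p0 qE dw) => [[v [c [w' [/iv_inj <- dw' _ ->]]]]|].
    have [c' ->] := tree_parallel spec rQ dU dw'.
    by exists (c' * c); rewrite mulrzA.
  by case=> j [c [w' [jq /esym/q_inner[]]]].
move=> _ qw.
have closed_or_nil x u : path_between x x u -> u = [::] \/ ev phi u = 0.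
  by case: (eqVneq u [::]) => [|u0 /(ear_closed rphi u0)]; [left | right].
(* The first letter [q_ 0] has an inner source because [q] has at least two letters; the others have
   inner targets. *)
case: i iq qw => [|i] iq qw.
  rewrite ear_src // in qw.
  case: (path_from_inner _ qw) => [|[j /andP[]]|[u + ->]] //.
    case: j => [|[|j]] // _ _ [/q_inj] .
    by move/(_ iq q_size).
  rewrite ear_tgt0 (take_nth (ia a)) // take0 => /closed_or_nil[->|u0].
    by exists 1; rewrite ev_seq1.
  by exists 0; rewrite ev_cat u0 mul0r.
have iq' : (0 < i.+1 < size q)%N by [].
case: w qw => [|x u].
  rewrite path_between_nil => /eqP.
  by move/(ear_src_inner iq iq') /esym/n_Sn.
rewrite path_between_cons => /andP[/eqP + xu].
case: (arr_earP x) xu => [[d ->]|[j jq ->]] xu.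
  by rewrite ia_tgt => /esym/(q_inner iq').
move/(q_inj jq iq) => ji; rewrite {j}ji in jq xu *.
case/closed_or_nil: xu => [->|u0]; first by exists 1; rewrite ev_seq1.
by exists 0; rewrite ev_cons u0 mulr0.
Qed.

Lemma tree_spec_ear : tree_spec UG wsG.
Proof.
split; [|  | exact: ear_closed | exact: ear_parallel].
- move=> w; rewrite mem_rcons inE => /predU1P[->|/mapP[u /(tree_cycles spec)]].
    rewrite wa_uniq wa_cycle; split=> //.
    by rewrite -(size_rot k) waE /= ltnS ltnW.
  case=> Uu cu su ->; rewrite map_inj_uniq // size_map; split=> //.
  rewrite cycle_map (eq_cycle (e' := @composable Q)) // => d e /=.
  by rewrite /composable ia_src ia_tgt (inj_eq iv_inj).
- move=> x; case: (arr_earP x) => [[e ->]|[i iq ->]].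
    rewrite mem_UG negb_or => /andP[ea /(tree_unglued spec)[w wE]].
    exists (map ia w); rewrite filter_rcons ia_mem_wa (negbTE ea) filter_map.
    rewrite -[RHS]/(map (map ia) [:: w]) -wE; congr map.
    by apply: eq_filter => u /=; rewrite mem_map.
  have qi : q_ i \in q by rewrite mem_nth.
  move=> _; exists wa; rewrite filter_rcons mem_wa qi orbT filter_map.
  rewrite (eq_filter (a2 := pred0)) ?filter_pred0 // => u /=.
  exact/negbTE/ear_notin_old.
Qed.

End Ear.

(** * Polygons and polygon-trees *)

Section CycleQuiver.
Variable n : nat.
Hypothesis n3 : (2 < n)%N.
Local Notation C := (cycle_quiver n).
Implicit Types x y : 'I_n.

Lemma cycle_enum : cycle (@composable C) (enum 'I_n).
Proof.
case: n n3 => // m _.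
pose R (i j : nat) := (i.+1 %% m.+1 == j)%N.
rewrite -[cycle _ _]/(cycle (relpre (@nat_of_ord m.+1) R) (enum 'I_m.+1)).
rewrite -cycle_map val_enum_ord /= rcons_path.
(* Along consecutive integers up to [m] the successor does not wrap around; only the closing step
   uses the modulus. *)
have H a l : (a + l <= m)%N ->
    path R a (iota a.+1 l) /\
    last a (iota a.+1 l) = (a + l)%N.
  elim: l a => [|l IH] a alm /=; first by rewrite addn0.
  have [|-> ->] := IH a.+1; first by rewrite addSnnS.
  rewrite /R addSnnS modn_small ?eqxx // ltnS (leq_trans _ alm) //.
  by rewrite addnS ltnS leq_addr.
by have [//|-> ->] := H 0%N m; rewrite /R add0n modnn eqxx.
Qed.

Lemma iter_ordS_eq s y : iter s (@ordS n) y = y -> (n %| s)%N.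
Proof.
have E : iter s (@ordS n) y = ((y + s) %% n)%N :> nat.
  elim: s => [|s IH]; first by rewrite addn0 modn_small.
  by rewrite iterS /= IH addnS -addn1 modnDml addn1.
move/(congr1 (@nat_of_ord n)); rewrite E.
rewrite -{2}(modn_small (ltn_ord y)) -{2}[nat_of_ord y]addn0.
by move/eqP; rewrite eqn_modDl mod0n.
Qed.

(** Each vertex of an oriented cycle is the target of one arrow, so target and length determine a
    path. *)
Lemma cycle_pathE x y w : @path_between C x y w ->
  w = traject (@ordS n) y (size w) /\ x = iter (size w) (@ordS n) y.
Proof.
elim: w y => [|e w IH] y; first by rewrite path_between_nil => /eqP.
rewrite path_between_cons => /andP[/eqP <-{y} /IH[wE xE]] /=.
by rewrite -wE xE -iterSr.
Qed.

Variable k : nat.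
Local Notation w0 := (rot k (enum 'I_n)).

Lemma rot_enum_cycle :
  [/\ uniq w0, cycle (@composable C) w0, size w0 = n & forall x, x \in w0].
Proof.
rewrite rot_uniq rot_cycle size_rot size_enum_ord enum_uniq cycle_enum.
by split=> // i; rewrite mem_rot mem_enum.
Qed.

Lemma cycle_cutE (y : 'I_n) : y :: cut y w0 = traject (@ordS n) y n.
Proof.
have [U c s m] := rot_enum_cycle.
have yc := @path_between_cut C y _ U c (m y).
have : @path_between C y y (y :: cut y w0).
  by rewrite path_between_cons eqxx.
case/cycle_pathE => -> _; congr traject.
by rewrite /= size_behead size_rot s prednK // (ltn_trans _ n3).
Qed.

(** The length of a nonempty closed path is a positive multiple of [n], so its word begins with a
    full turn, an arrow times its own derivative. A path parallel to [e] is [e] times a closed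
    path. *)
Lemma tree_spec_cycle : @tree_spec C set0 [:: w0].
Proof.
have [Uw cw sw mw] := rot_enum_cycle.
have closed (A : pzRingType) (phi : arr C -> A) :
    relations phi set0 [:: w0] -> forall v w, w != [::] ->
    @path_between C v v w -> ev phi w = 0.
  move=> rphi v w wn /cycle_pathE[wE /esym/iter_ordS_eq nw].
  have {}nw : (n <= size w)%N by rewrite dvdn_leq // lt0n size_eq0.
  rewrite wE -(subnKC nw) trajectD -cycle_cutE ev_cat ev_cons.
  have [+ _] := rphi.2 v; rewrite /ev_der big_cons big_nil mw addr0 => ->.
  by rewrite mul0r.
split=> //.
- by move=> w; rewrite inE => /eqP ->; rewrite sw ltnW.
- by move=> e _; exists w0; rewrite /= mw.
move=> A phi rphi e [|x w] _; first rewrite path_between_nil => /eqP.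
  (* An empty path parallel to [e] would make [e] a loop, so [n] would divide 1. *)
  by move/(@iter_ordS_eq 1%N)/dvdn_leq => /(_ isT); rewrite leqNgt ltnW.
rewrite path_between_cons => /andP[/eqP] /= -> ew.
have [->|w1] := eqVneq w [::]; first by exists 1; rewrite ev_seq1.
by exists 0; rewrite ev_cons (closed _ _ rphi _ _ w1 ew) mulr0.
Qed.

(** * The concrete gluing seen as attaching an ear *)

Variables (Q : quiver) (a : arr Q) (b : arr C).
Local Notation G := (glue a b).
Local Notation gv := (glue_inr_vert a b).
Local Notation ga := (glue_inr_arr a b).

Lemma glue_inr_arr_b : ga b = inl a.
Proof. by rewrite /glue_inr_arr insubF // eqxx. Qed.

Lemma glue_inr_arr_neq e (eb : e != b) : ga e = inr (Sub e eb).
Proof. by rewrite /glue_inr_arr insubT. Qed.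

Lemma cycle_src_neq_tgt : src b != tgt b.
Proof.
apply/eqP => /(@iter_ordS_eq 1%N)/dvdn_leq => /(_ isT).
by rewrite leqNgt ltnW.
Qed.

Lemma glue_inr_vert_src : gv (src b) = inl (src a).
Proof. by rewrite /glue_inr_vert insubF ?eqxx // !inE eqxx. Qed.

Lemma glue_inr_vert_tgt : gv (tgt b) = inl (tgt a).
Proof.
rewrite /glue_inr_vert insubF; last by rewrite !inE eqxx orbT.
by rewrite eq_sym (negbTE cycle_src_neq_tgt).
Qed.

Lemma glue_inr_vert_inner v (vb : v \notin [:: src b; tgt b]) :
  gv v = inr (Sub v vb).
Proof. by rewrite /glue_inr_vert insubT. Qed.

Lemma glue_inr_src e : src (ga e : arr G) = gv (src e).
Proof.
case: (eqVneq e b) => [->|eb]; last by rewrite (glue_inr_arr_neq eb).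
by rewrite glue_inr_arr_b glue_inr_vert_src.
Qed.

Lemma glue_inr_tgt e : tgt (ga e : arr G) = gv (tgt e).
Proof.
case: (eqVneq e b) => [->|eb]; last by rewrite (glue_inr_arr_neq eb).
by rewrite glue_inr_arr_b glue_inr_vert_tgt.
Qed.

Lemma glue_inr_path x y w : @path_between C x y w ->
  @path_between G (gv x) (gv y) (map ga w).
Proof.
elim: w y => [|e w IH] y; rewrite /= !(path_between_nil, path_between_cons).
  by move/eqP ->.
by case/andP=> /eqP <- /IH; rewrite glue_inr_src glue_inr_tgt eqxx.
Qed.

(** The polygon rotated to start at [b] reads [b :: u], and the image of [u] is the ear. *)
Lemma tree_spec_glue (U : {set arr Q}) ws : tree_spec U ws -> a \notin U ->
  @tree_spec G [set inl e | e in a |: U]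
    (rcons [seq [seq inl e | e <- w] | w <- ws] [seq ga e | e <- w0]).
Proof.
move=> spec aU; have [Uw cw sw mw] := rot_enum_cycle.
have [j u uE] := rot_to (mw b).
have u_uniq : uniq (b :: u) by rewrite -uE rot_uniq.
have /andP[bu Uu] := u_uniq.
have uP e : (e \in u) = (e != b).
  apply/idP/idP => [|eb]; first by apply: contraTneq => ->.
  by have := mw e; rewrite -(mem_rot j w0) uE inE (negbTE eb).
have su : (size u).+1 = n by have := sw; rewrite -(size_rot j) uE.
have su1 : (1 < size u)%N by rewrite -ltnS su.
have u_path : @path_between C (tgt b) (src b) u.
  by rewrite -(cut_rot_eq Uw uE) path_between_cut.
have u0 : nth b u 0 = src b.
  case: u su1 u_path {su uE u_uniq bu Uu uP} => [|x s] //=.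
  by rewrite path_between_cons => _ /andP[/eqP].
have tgt_q i : (i < size u)%N ->
    tgt (nth (inl a : arr G) (map ga u) i) = gv (nth b u i).
  by move=> iu; rewrite (nth_map b) // glue_inr_tgt.
have nth_b i : (i < size u)%N -> nth b u i != b.
  by move=> iu; rewrite -uP mem_nth.
have nth_inner i : (0 < i < size u)%N -> nth b u i \notin [:: src b; tgt b].
  case/andP=> i0 iu; rewrite !inE negb_or nth_b // andbT -u0 nth_uniq //.
    by rewrite -lt0n.
  exact: ltn_trans iu.
have ga_inj : {in u &, injective ga}.
  move=> x y; rewrite !uP => xb yb.
  by rewrite (glue_inr_arr_neq xb) (glue_inr_arr_neq yb) => -[].
(* Arrows of the cycle are named by their targets, so ear arrows end at vertices other than the
   target of [b]; of these only the source of [b] is merged with an old vertex. *)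
have gv_inj x y : x != b -> y != b -> gv x = gv y -> x = y.
  have gvE z : z != b -> (z = src b /\ gv z = inl (src a)) \/
      exists zb : z \notin [:: src b; tgt b], gv z = inr (Sub z zb).
    move=> zb; case: (eqVneq z (src b)) => [->|zs].
      by left; rewrite glue_inr_vert_src.
    have zi : z \notin [:: src b; tgt b] by rewrite !inE negb_or zs.
    by right; exists zi; rewrite (glue_inr_vert_inner zi).
  move=> /gvE[[-> ->]|[xi ->]] /gvE[[-> ->]|[yi ->]] //.
  by case.
apply: (@tree_spec_ear Q G inl inl a (map ga u) _ _ _ _ _ _ _ _ _ _ _ _ _ _ _ j);
  rewrite ?size_map //.
- by move=> x y [].
- by move=> x y [].
- move=> e; apply/mapP => -[x]; rewrite uP => xb.
  by rewrite (glue_inr_arr_neq xb).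
- case=> [e|s] xq; first by exists e.
  case/mapP: xq; exists (val s); first by rewrite uP (valP s).
  by rewrite (glue_inr_arr_neq (valP s)); congr inr; apply: val_inj.
- by rewrite map_inj_in_uniq.
- by rewrite -glue_inr_vert_src -glue_inr_vert_tgt glue_inr_path.
- move=> i v iu; have [_ iS] := andP iu.
  move/(etrans (esym (tgt_q i iS))).
  by rewrite (glue_inr_vert_inner (nth_inner _ iu)).
- move=> i i' iu iu' E.
  have {}E := gv_inj _ _ (nth_b _ iu) (nth_b _ iu')
    (etrans (esym (tgt_q i iu)) (etrans E (tgt_q i' iu'))).
  by apply/eqP; rewrite -(nth_uniq b iu iu' Uu) E.
- case=> [v|s]; first by left; exists v.
  have := valP s; rewrite !inE negb_or => /andP[ss sb]; right.
  have si : (index (val s) u < size u)%N by rewrite index_mem uP.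
  exists (index (val s) u).
    rewrite si andbT lt0n; apply: contraNneq ss => s0.
    by have := nth_index b (etrans (uP (val s)) sb); rewrite s0 u0 => <-.
  apply/esym/(etrans (tgt_q _ si)); rewrite nth_index ?uP //.
  by rewrite (glue_inr_vert_inner (valP s)); congr inr; apply: val_inj.
- by rewrite -map_rot uE /= glue_inr_arr_b.
Qed.

End CycleQuiver.

Lemma polygon_tree_spec (Q : quiver) (U : {set arr Q}) ws :
  polygon_tree U ws -> tree_spec U ws.
Proof.
elim=> {Q U ws} [n k n3|Q U ws n k a b _ spec n3 aU|Q Q' f U ws _ spec].
- exact: tree_spec_cycle.
- exact: tree_spec_glue.
- exact: tree_spec_iso.
Qed.

(** * The complete path algebra *)

Lemma spanning_finite_dimensional (K : fieldType) (V : lmodType K) m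
    (v : 'I_m -> V) :
  (forall x, exists c : 'I_m -> K, x = \sum_i c i *: v i) ->
  finite_dimensional V.
Proof.
elim: m v => [|m IH] v span.
  have span0 x : x = 0 :> V by have [c ->] := span x; rewrite big_ord0.
  exists 0%N; constructor; exists (fun=> 0) => [a x y|].
    by rewrite scaler0 addr0.
  by exists (fun=> 0) => [x|u]; rewrite ?[RHS]span0 ?[RHS]thinmx0.
have [[c [c0 [i ci]]]|indep] := pselect (exists c : 'I_m.+1 -> K,
    \sum_i c i *: v i = 0 /\ exists i, c i != 0).
  apply: (IH (fun j => v (lift i j))) => x; have [d ->] := span x.
  exists (fun j => d (lift i j) - d i / c i * c (lift i j)).
  have vi : v i = - \sum_(j < m) (c (lift i j) / c i) *: v (lift i j).
    apply: (scalerI ci); rewrite scalerN scaler_sumr.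
    apply/eqP; rewrite -addr_eq0; apply/eqP; rewrite -[RHS]c0 (bigD1_ord i) //=.
    congr (_ + _); apply: eq_bigr => j _.
    by rewrite scalerA mulrCA divff // mulr1.
  rewrite (bigD1_ord i) //= vi scalerN scaler_sumr addrC -sumrB.
  apply: eq_bigr => j _; rewrite scalerBl scalerA; congr (_ - _ *: _).
  by rewrite mulrA mulrAC.
pose r2v (u : 'rV[K]_m.+1) := \sum_i u 0 i *: v i.
have r2vL a u w : r2v (a *: u + w) = a *: r2v u + r2v w.
  rewrite /r2v scaler_sumr -big_split; apply: eq_bigr => i _ /=.
  by rewrite !mxE scalerDl scalerA.
have r2vI : injective r2v.
  move=> u w uw; apply/eqP; rewrite -subr_eq0; apply/eqP/rowP => i.
  rewrite [RHS]mxE; apply: contrapT => /eqP ui; apply: indep.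
  exists (fun i => (u - w) 0 i); split; last by exists i.
  rewrite -/(r2v (u - w)) addrC -scaleN1r r2vL uw scaleN1r addNr //.
have /choice[v2r v2rK] : forall x, exists u, r2v u = x.
  move=> x; have [c ->] := span x; exists (\row_i c i).
  by apply: eq_bigr => i _; rewrite mxE.
exists m.+1; constructor; exists v2r.
  by move=> a x y; apply: r2vI; rewrite r2vL !v2rK.
by exists r2v => // u; apply: r2vI; rewrite v2rK.
Qed.

(** * Products and cyclic derivatives of path elements *)

Section PathElements.
Variables (Q : quiver) (K : fieldType).
Local Notation cpaQ := (cpa Q K).
Local Notation path_elt := (@path_elt Q K).
Implicit Types (x y z : cpaQ) (p : qpath Q) (j : vert Q) (e : arr Q).

Lemma cpa_sumE (I : Type) (r : seq I) (P : pred I) (F : I -> cpaQ) p :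
  (\sum_(i <- r | P i) F i) p = \sum_(i <- r | P i) F i p.
Proof. exact: (big_morph (fun x : cpaQ => x p)). Qed.

(** Only the factorisation whose left part has length [size u] contributes; if [p] is too short,
    both sides are zero. *)
Lemma path_elt_mulE j u y p : (path_elt j u * y) p =
  ((ptgt p, take (size u) (pword p)) == (j, u))%:R * y (pright (size u) p).
Proof.
have [up|pu] := leqP (size u) (plen p).
  rewrite [LHS](bigD1 (Ordinal (up : (size u < (plen p).+1)%N))) //=.
  rewrite big1 ?addr0 // => k ku.
  rewrite /Defs.path_elt /= [X in nat_of_bool X](_ : _ = false).
    by rewrite mul0r.
  apply/eqP => -[_ E]; case/eqP: ku; apply: val_inj => /=.
  by rewrite -E size_takel // -ltnS.
rewrite [X in nat_of_bool X](_ : _ = false); last first.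
  apply/eqP => -[_ /(congr1 size)]; rewrite size_take_min => /minn_idPl.
  by rewrite leqNgt pu.
rewrite mul0r [LHS]big1 // => k _; rewrite /Defs.path_elt /=.
rewrite [X in nat_of_bool X](_ : _ = false) ?mul0r //.
apply/eqP => -[_ E]; move: pu; rewrite -E size_takel ?ltnNge -1?ltnS //.
by rewrite ltn_ord.
Qed.

Lemma idem_mulE j y p : (idem K j * y) p = (ptgt p == j)%:R * y p.
Proof.
rewrite path_elt_mulE take0 xpair_eqE eqxx andbT; congr (_ * y _).
by apply: val_inj; case: p => -[i w] pw; rewrite /= /pword take0 drop0.
Qed.

Lemma mul_idemE j y p :
  (y * idem K j) p = y p * (word_src (ptgt p) (pword p) == j)%:R.
Proof.
rewrite [LHS](bigD1 ord_max) //= big1 => [|k kM].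
  rewrite addr0; congr (y _ * _).
    by apply: val_inj; case: p => -[i w] pw; rewrite /= /plen take_size.
  rewrite /idem /Defs.path_elt /= /plen take_size drop_size.
  by rewrite xpair_eqE eqxx andbT.
rewrite /idem /Defs.path_elt /= xpair_eqE [X in _ && X](_ : _ = false).
  by rewrite andbF mulr0.
apply/eqP => /(congr1 size)/eqP; rewrite size_drop /= subn_eq0 => pk.
case/eqP: kM; apply/val_inj/eqP; rewrite eqn_leq /= pk andbT.
by rewrite -ltnS ltn_ord.
Qed.

Lemma path_elt_cons e w :
  path_elt (tgt e) [:: e] * path_elt (src e) w = path_elt (tgt e) (e :: w).
Proof.
apply/funext => p; rewrite path_elt_mulE /Defs.path_elt -natrM mulnb.
congr (nat_of_bool _)%:R; case: p => -[j [|x s]] ps.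
  by rewrite /ptgt /pword /= !xpair_eqE !andbF.
rewrite /ptgt /pword /= take0 drop0 !xpair_eqE !eqseq_cons andbT /word_src /=.
case: (eqVneq x e) => [->|_]; last by rewrite !andbF.
by rewrite eqxx andbT.
Qed.

Lemma coefD x y j w : coef (x + y) j w = coef x j w + coef y j w.
Proof. by rewrite /coef; case: insub => //=; rewrite addr0. Qed.

Lemma cyc_derivativeD e x y :
  cyc_derivative e (x + y) = cyc_derivative e x + cyc_derivative e y.
Proof.
apply/funext => p; rewrite -[RHS]/(_ p + _ p) /cyc_derivative -big_split.
by apply: eq_bigr => c _; rewrite coefD mulrDl.
Qed.

Lemma cyc_derivative0 e : cyc_derivative e (0 : cpaQ) = 0.
Proof.
apply/funext => p; rewrite [LHS]big1 // => c _.
by rewrite /coef; case: insub => *; rewrite /= mul0r.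
Qed.

(** Only [w] itself, not its other rotations, carries a coefficient, and [e] occurs in it at most
    once, so at most one term of the double sum survives. *)
Lemma cyc_derivative_cycle_elt e w :
  uniq w -> cycle (@composable Q) w -> (0 < size w)%N ->
  cyc_derivative e (cycle_elt K w) =
  if e \in w then path_elt (src e) (cut e w) else 0.
Proof.
move=> Uw cw sw; apply/funext => p.
have coefE (c : (plen p).+1.-tuple (arr Q)) : cycle (@composable Q) c ->
    coef (cycle_elt K w) (tgt (thead c)) c = (tval c == w)%:R.
  case/tupleP: c => b s /=; rewrite theadE => cs; rewrite /coef insubT /=.
    by rewrite eqxx /=; move: cs; rewrite rcons_path => /andP[].
  move=> ps; case: w sw {Uw cw} => // x w _; rewrite /cycle_elt /Defs.path_elt /=.
  rewrite xpair_eqE; case: (eqVneq (b :: s) (x :: w)) => [[-> _]|_].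
    by rewrite eqxx.
  by rewrite andbF.
rewrite /cyc_derivative; have [wp|wp] := eqVneq (size w) (plen p).+1; last first.
  rewrite big1 => [|c cc]; last first.
    rewrite coefE // [X in nat_of_bool X](_ : _ = false) ?mul0r //.
    by apply: contraNF wp => /eqP <-; rewrite size_tuple.
  case: ifP => // ew; rewrite /Defs.path_elt [X in nat_of_bool X](_ : _ = false) //.
  apply: contraNF wp => /eqP pE; rewrite /plen /pword pE /= size_behead size_rot.
  by rewrite prednK.
have sz : size w == (plen p).+1 by rewrite wp.
rewrite (bigD1 (Tuple sz)) //= big1 => [|c /andP[cc cw']]; last first.
  rewrite coefE // [X in nat_of_bool X](_ : _ = false) ?mul0r //.
  by apply: contraNF cw' => /eqP cE; apply/eqP/val_inj.
rewrite coefE // eqxx mul1r addr0 /cyc_derivative_word cpa_sumE.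
have tnthE k : tnth (Tuple sz) k = nth e w k by rewrite (tnth_nth e).
case: ifP => ew; last first.
  rewrite big1 // => k; rewrite tnthE => /eqP E; move/negP: ew; case.
  by rewrite -E mem_nth // wp.
have iw : (index e w < (plen p).+1)%N by rewrite -wp index_mem.
rewrite (bigD1 (Ordinal iw)) /=; last by rewrite tnthE /= nth_index.
rewrite big1 => [|k /andP[]]; first by rewrite addr0 cutE.
rewrite tnthE => /eqP E /eqP; case; apply: val_inj => /=.
by rewrite -E index_uniq // wp.
Qed.

End PathElements.

(** * The Jacobian algebra *)

Section JacobianIdeal.
Variables (Q : quiver) (K : fieldType) (W : cpa Q K).
Local Notation cpaQ := (cpa Q K).
Local Notation path_elt := (@path_elt Q K).
Local Notation I := (jacobian_ideal W).
Local Notation J := (jacobian W).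
Local Notation pi := (jac_pi W).
Implicit Types (x y z : cpaQ) (p : qpath Q) (j : vert Q) (e : arr Q).

Lemma jac_pi_eq x y : (pi x = pi y) <-> (x - y \in I).
Proof.
have -> : (x - y \in I) = (pi x == pi y) by rewrite [RHS]quotmod_pi_eq.
by split=> /eqP.
Qed.

Lemma jac_pi0 : pi 0 = 0.
Proof. by apply: (addrI (pi 0)); rewrite -jac_piD !addr0. Qed.

Lemma jac_pi_eq0 x : (pi x = 0) <-> (x \in I).
Proof. by rewrite -jac_pi0 jac_pi_eq subr0. Qed.

Lemma jac_pi_sum (T : Type) (r : seq T) (P : pred T) (F : T -> cpaQ) :
  pi (\sum_(i <- r | P i) F i) = \sum_(i <- r | P i) pi (F i).
Proof. exact: (big_morph pi (jac_piD W) jac_pi0). Qed.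

Lemma jac_piZ (c : K) x : pi (c *: x) = c *: pi x.
Proof. by symmetry; apply: quotmod_pi_scale. Qed.

Lemma jac_pi_derivative e : pi (cyc_derivative e W) = 0.
Proof.
apply/jac_pi_eq0/asboolP => n; exists (cyc_derivative e W) => //.
by apply/asboolP => I' _; apply; exists e.
Qed.

Lemma jac_pi_closure z :
  (forall n, exists2 y, y \in I & forall p, (plen p < n)%N -> z p = y p) ->
  z \in I.
Proof.
move=> zI; apply/asboolP => n; have [y /asboolP/(_ n)[t tI yt] zy] := zI n.
by exists t => // p pn; rewrite zy // yt.
Qed.

(** The sum runs over a finite type that also contains pairs that are not paths; for these [coef] is
    0. *)
Definition truncation n z : cpaQ :=
  \sum_(u : vert Q * n.-bseq (arr Q)) coef z u.1 u.2 *: path_elt u.1 u.2.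

Lemma coef_path z p : coef z (ptgt p) (pword p) = z p.
Proof.
by rewrite /coef -[(ptgt p, _)]/(ptgt p, (val p).2) -surjective_pairing valK.
Qed.

Lemma truncationE n z p : (plen p <= n)%N -> truncation n z p = z p.
Proof.
move=> pn; rewrite /truncation cpa_sumE (bigD1 (ptgt p, Bseq pn)) //=.
rewrite big1 => [|u up].
  rewrite addr0 -[LHS]/(coef z (ptgt p) (pword p) * path_elt _ _ p).
  by rewrite /Defs.path_elt /ptgt /pword -surjective_pairing eqxx mulr1 coef_path.
rewrite -[LHS]/(coef z u.1 u.2 * path_elt u.1 u.2 p) /Defs.path_elt.
rewrite [X in nat_of_bool X](_ : _ = false) ?mulr0 //.
apply: contraNF up => /eqP pE; apply/eqP; case: u pE => j s pE.
have [-> sE] : j = ptgt p /\ bseqval s = pword p by rewrite /ptgt /pword pE.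
by congr pair; apply: val_inj.
Qed.

(** The truncations are finite combinations of elements of the ideal, and the ideal is closed. *)
Lemma mem_jacobian_support z :
  (forall p, z p != 0 -> path_elt (ptgt p) (pword p) \in I) -> z \in I.
Proof.
move=> zI; apply: jac_pi_closure => n; exists (truncation n z); last first.
  by move=> p /ltnW pn; rewrite truncationE.
apply/jac_pi_eq0; rewrite jac_pi_sum big1 // => -[j s] _ /=.
rewrite jac_piZ /coef; case: insubP => [p _ pE|_] /=; last by rewrite scale0r.
have [->|/zI/jac_pi_eq0] := eqVneq (z p) 0; first by rewrite scale0r.
by rewrite /ptgt /pword pE => ->; rewrite scaler0.
Qed.

Definition jac_arr e : J := pi (path_elt (tgt e) [:: e]).

(** The empty word is excluded: its path element is a vertex idempotent, whereas [ev] gives 1. *)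
Lemma jac_pi_path j w : w != [::] -> is_path j w ->
  pi (path_elt j w) = ev jac_arr w.
Proof.
elim: w j => // e [|d w] IH j _ /andP[/eqP <-]; first by rewrite ev_seq1.
move=> /= /andP[ed dw]; rewrite ev_cons -(IH (src e)) //; last first.
  by rewrite /= dw eq_sym -[_ == _]/(composable e d) ed.
by rewrite -path_elt_cons -jac_piM.
Qed.

(** * The Jacobian algebra of a polygon-tree *)

Variables (U : {set arr Q}) (ws : seq (seq (arr Q))).
Hypotheses (spec : tree_spec U ws) (WE : W = \sum_(w <- ws) cycle_elt K w).

Lemma cyc_derivative_tree e :
  cyc_derivative e W = \sum_(w <- ws | e \in w) path_elt (src e) (cut e w).
Proof.
rewrite WE (big_morph _ (cyc_derivativeD e) (cyc_derivative0 K e)).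
rewrite [RHS]big_mkcond; apply: eq_big_seq => w /(tree_cycles spec)[Uw cw sw].
by rewrite cyc_derivative_cycle_elt // ltnW.
Qed.

Lemma cut_nonempty e w : w \in ws -> cut e w != [::].
Proof.
move=> /(tree_cycles spec)[_ _ sw].
by rewrite -size_eq0 size_behead size_rot; case: (size w) sw => [|[]].
Qed.

Lemma jac_relations : relations jac_arr U ws.
Proof.
have D0 e : ev_der jac_arr ws e = 0.
  rewrite -(jac_pi_derivative e) cyc_derivative_tree jac_pi_sum /ev_der.
  rewrite big_seq_cond [RHS]big_seq_cond; apply: eq_bigr => w /andP[wws ew].
  rewrite jac_pi_path ?cut_nonempty //.
  have [Uw cw _] := tree_cycles spec wws.
  by have /andP[] := path_between_cut Uw cw ew.
by split=> e; rewrite D0 // mulr0 mul0r.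
Qed.

Lemma ev_closed_jac j w : w != [::] -> path_between j j w -> ev jac_arr w = 0.
Proof. exact: (tree_closed spec jac_relations). Qed.

Lemma closed_path_mem_jacobian j w : w != [::] -> path_between j j w ->
  path_elt j w \in I.
Proof.
move=> w0 jw; apply/jac_pi_eq0; rewrite jac_pi_path ?(ev_closed_jac w0 jw) //.
by case/andP: jw.
Qed.

Lemma long_path_mem_jacobian p : (#|vert Q| <= plen p)%N ->
  path_elt (ptgt p) (pword p) \in I.
Proof.
case: p => -[j w] /= jw; rewrite /ptgt /plen /pword /= => sw.
have w0 : w != [::].
  by apply: contraTneq sw => ->; rewrite -ltnNge; apply/card_gt0P; exists j.
apply/jac_pi_eq0; rewrite jac_pi_path //.
(* A path visits one more vertex than it has arrows, so some vertex repeats; the subpath between two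
   visits is closed and evaluates to zero. *)
pose v (k : 'I_(size w).+1) := word_src j (take k w).
have : ~ injective v.
  by move/leq_card; rewrite card_ord leqNgt ltnS sw.
move/injectiveP/injectivePn => [k [l + vE]].
wlog kl : k l vE / (k < l)%N => [H|_].
  by rewrite neq_ltn => /orP[kl|lk]; [apply: (H k l)|apply: (H l k)] => //;
    rewrite neq_ltn ?kl ?lk ?orbT.
have lw : (l <= size w)%N by rewrite -ltnS ltn_ord.
have : path_between (word_src j w) j w by rewrite /path_between jw eqxx.
rewrite -{2}(cat_take_drop l w) path_between_cat => /andP[jl _].
have takeE : take l w = take k w ++ drop k (take l w).
  by rewrite -{1}(cat_take_drop k (take l w)) take_takel // ltnW.
move: jl; rewrite {2}takeE path_between_cat => /andP[_].
rewrite -[X in path_between X]/(v l) -[X in path_between _ X]/(v k) -vE.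
move/(@ev_closed_jac _ (drop k (take l w))) => H.
rewrite -(cat_take_drop l w) takeE !ev_cat H ?mulr0 ?mul0r //.
by rewrite -size_eq0 size_drop size_takel // -lt0n subn_gt0.
Qed.

(** Paths of length at most [n] span, since an element minus its truncation is supported on longer
    paths, which lie in the ideal. *)
Lemma jacobian_finite_dimensional : finite_dimensional J.
Proof.
pose n := #|vert Q|; pose T : finType := (vert Q * n.-bseq (arr Q))%type.
pose v (u : T) : J := pi (path_elt u.1 u.2).
apply: (@spanning_finite_dimensional K J #|T| (fun k => v (enum_val k))) => u.
have [z ->] := jac_piP u.
pose c (t : T) := coef z t.1 t.2; exists (fun k => c (enum_val k)).
rewrite -(big_enum_val (A := T) (fun t : T => c t *: v t)) /=.
under eq_bigr do rewrite -jac_piZ; rewrite -jac_pi_sum.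
rewrite -/(truncation n z).
apply/jac_pi_eq/mem_jacobian_support => p; rewrite -[_ p]/(z p - _ p).
have [pn|pn] := leqP (plen p) n; first by rewrite truncationE // subrr eqxx.
by move=> _; apply: long_path_mem_jacobian; apply: ltnW.
Qed.

Definition trivial_path j : qpath Q := exist _ (j, [::]) isT.

Lemma mul_trivial_path x y j :
  (x * y) (trivial_path j) = x (trivial_path j) * y (trivial_path j).
Proof.
by rewrite [LHS]big_ord1; congr (x _ * y _); apply: val_inj.
Qed.

Lemma jacobian_trivial_path z j : z \in I -> z (trivial_path j) = 0.
Proof.
(* Approximation up to length 0 already preserves this coefficient. Its vanishing defines a
   two-sided ideal containing all derivatives, whose words are nonempty. *)
move/asboolP/(_ 1%N) => [y /asboolP yI ->] //.
pose M : {pred cpaQ} := [pred x : cpaQ | x (trivial_path j) == 0].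
suff /yI H : two_sided_ideal M.
  apply/eqP/H => x [e ->]; rewrite inE cyc_derivative_tree cpa_sumE big1_seq //.
  move=> w /andP[_ wws]; rewrite /Defs.path_elt /= xpair_eqE eq_sym.
  by rewrite eq_sym [[::] == _]eq_sym (negbTE (cut_nonempty _ wws)) andbF.
split; first split; rewrite ?inE //.
- by move=> x t /eqP xE /eqP tE; rewrite inE -[X in X == _]/(x _ - t _) xE tE subrr.
- by move=> x t /eqP tE; rewrite inE mul_trivial_path tE mulr0.
- by move=> x t /eqP xE; rewrite inE mul_trivial_path xE mul0r.
Qed.

(** * The radical of the projective module at a vertex *)

Variable i : vert Q.
Local Notation P := (proj_mod W i).

(** The choice of representative does not matter, by [jacobian_trivial_path]; this is the character
    of the algebra at the vertex [i]. *)
Definition aug (u : J) : K := repr u (trivial_path i).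

Lemma aug_pi z : aug (pi z) = z (trivial_path i).
Proof.
apply/eqP; rewrite -subr_eq0; apply/eqP.
rewrite -[LHS]/((repr (pi z) - z) (trivial_path i)).
apply: jacobian_trivial_path; apply/jac_pi_eq.
by rewrite /jac_pi reprK.
Qed.

Lemma augD u v : aug (u + v) = aug u + aug v.
Proof.
have [x ->] := jac_piP u; have [y ->] := jac_piP v.
by rewrite -jac_piD !aug_pi.
Qed.

Lemma augM u v : aug (u * v) = aug u * aug v.
Proof.
have [x ->] := jac_piP u; have [y ->] := jac_piP v.
by rewrite [_ * _]jac_piM !aug_pi mul_trivial_path.
Qed.

Lemma augZ (c : K) : aug (c *: (1 : J)) = c.
Proof. by rewrite -[1]/(pi 1) -jac_piZ aug_pi -[LHS]/(c * 1) mulr1. Qed.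

Lemma augB u v : aug (u - v) = aug u - aug v.
Proof. by apply/eqP; rewrite eq_sym subr_eq -augD subrK. Qed.

Lemma idem_proj_pred : proj_pred i (pi (idem K i) : J^o).
Proof. by apply/asboolP; exists 1; rewrite mul1r. Qed.

Definition idem_proj : P := Sub (pi (idem K i) : J^o) idem_proj_pred.

Lemma aug_idem : aug (pi (idem K i)) = 1.
Proof. by rewrite aug_pi /idem /Defs.path_elt eqxx. Qed.

Lemma val_projZ (r : J) (x : P) : val (r *: x) = r * (val x : J).
Proof. by []. Qed.

Definition aug_ker : {pred P} := [pred x : P | aug (val x : J) == 0].

Lemma aug_ker_maximal : maximal_submod aug_ker.
Proof.
split.
- split; first by rewrite inE -[val 0]/(0 : J) -jac_pi0 aug_pi.
  move=> r x y /eqP xE /eqP yE; rewrite inE.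
  by rewrite -[val _]/(r * (val x : J) + (val y : J)) augD augM xE yE mulr0 addr0.
- by exists idem_proj; rewrite inE aug_idem oner_eq0.
move=> T [T0 TL] kerT.
have [[x xT xk]|TK] := pselect (exists2 x, x \in T & x \notin aug_ker).
  right=> y; rewrite [RHS]inE; pose c := aug (val y : J) / aug (val x : J).
  (* The kernel has codimension one: subtracting a suitable multiple of [x] moves any [y] into
     it. *)
  have -> : y = (c *: (1 : J)) *: x + (y - (c *: (1 : J)) *: x).
    by rewrite addrC subrK.
  apply: TL => //; apply: kerT; rewrite inE.
  rewrite -[val _]/((val y : J) - (c *: (1 : J)) * (val x : J)).
  by rewrite augB augM augZ divfK ?subrr.
left=> x; apply/idP/idP => [xT|]; last exact: kerT.
by apply: contrapT => xk; apply: TK; exists x => //; apply/negP.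
Qed.

Lemma rad_sub_aug_ker (x : P) : x \in rad P -> aug (val x : J) = 0.
Proof. by move/asboolP/(_ _ aug_ker_maximal)/eqP. Qed.

(** Such an [x] lies in the corner at [i], so it lifts to a combination of closed paths at [i], all
    of which vanish except the trivial one. *)
Lemma idem_corner (x : P) : (pi (idem K i) : J) *: x = x ->
  (val x : J) = aug (val x : J) *: pi (idem K i).
Proof.
move=> xE; have := valP x => /asboolP[v vE].
have {xE}vE : (val x : J) = pi (idem K i) * (v * pi (idem K i)).
  by rewrite -vE -[in LHS]xE.
have [y yE] := jac_piP v.
have {v vE yE}zE : (val x : J) = pi (idem K i * (y * idem K i)).
  by rewrite vE yE [X in _ * X]jac_piM; apply: jac_piM.
rewrite zE aug_pi -jac_piZ; apply/jac_pi_eq/mem_jacobian_support => p.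
set z := idem K i * _; rewrite -[_ p]/(z p - z (trivial_path i) * idem K i p).
have zpE : z p = (ptgt p == i)%:R * (y p * (word_src (ptgt p) (pword p) == i)%:R).
  by rewrite /z idem_mulE mul_idemE.
have idE : idem K i p = ((ptgt p == i) && (pword p == [::]))%:R by [].
case: (eqVneq (ptgt p) i) zpE idE => [pi_i|_] -> ->; last first.
  by rewrite mul0r mulr0 subrr eqxx.
case: (eqVneq (pword p) [::]) => [p0|p0].
  have -> : p = trivial_path i.
    by apply: val_inj; rewrite /= [val p]surjective_pairing; congr pair.
  by rewrite /z idem_mulE mul_idemE /= !eqxx !mulr1 subrr eqxx.
rewrite mulr0 subr0 mul1r.
case: (eqVneq (word_src (ptgt p) (pword p)) i) => [srcE _|_]; last by rewrite mulr0 eqxx.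
rewrite pi_i; apply: closed_path_mem_jacobian => //.
by rewrite /path_between -{1 2}pi_i srcE eqxx andbT; apply: (valP p).
Qed.

Lemma simple_not_in_rad : ~ embeds_in_rad (simple_mod W i) P.
Proof.
case=> f [f_inj f_rad].
pose s : simple_mod W i := \pi_(simple_mod W i)%qT idem_proj.
have sE : (pi (idem K i) : J) *: s = s.
  rewrite [LHS]quotmod_pi_scale; congr \pi_(_)%qT; apply: val_inj.
  rewrite val_projZ /= [LHS]jac_piM; congr jac_pi.
  apply/funext => p; rewrite idem_mulE /idem /Defs.path_elt.
  by case: p => -[j w] pw; rewrite -natrM mulnb /ptgt /= xpair_eqE andbA andbb.
have fsE : (pi (idem K i) : J) *: f s = f s by rewrite -linearZ /= sE.
have fs0 : f s = 0.
  by apply: val_inj; rewrite (idem_corner fsE) rad_sub_aug_ker // scale0r.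
have s0 : s = 0 by apply: f_inj; rewrite fs0 raddf0.
(* Written as [s + s = s], the vanishing of [s] compares two classes whose representatives differ by
   the idempotent, which would then lie in the radical although [aug] maps it to 1. *)
have /eqP : s + s = s by rewrite s0 addr0.
rewrite -[s + s]quotmod_piD quotmod_pi_eq addrK => /rad_sub_aug_ker/eqP.
by rewrite aug_idem oner_eq0.
Qed.

End JacobianIdeal.

Theorem proposition3p8 (K : closedFieldType) (Q : quiver) (W : cpa Q K)
    (QW_polygon_tree : polygon_tree_qp W) :
  finite_dimensional (jacobian W) /\
  forall i : vert Q, ~ embeds_in_rad (simple_mod W i) (proj_mod W i).
Proof.
have [U [ws [/polygon_tree_spec spec WE]]] := QW_polygon_tree.
split; first exact: jacobian_finite_dimensional spec WE.
by move=> i; apply: (simple_not_in_rad spec WE).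
Qed.
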